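(* Let $n\ge 1$ and let $K=\sum_{i=1}^n X_i$, where $X_1,\dots,X_n$ are i.i.d. Bernoulli random variables with $\Pr\{X_i=1\}=p=1-\Pr\{X_i=0\}$, $p\in(0,1)$. Let $[a,b]\subset(0,1)$. Suppose that both $L(k)$ and $U(k)$ are monotone functions of $k\in\{0,1,\dots,n\}$. Then the minimum of $\Pr\{L(K)<p<U(K)\mid p\}$ with respect to $p\in[a,b]$ is attained at the discrete set $$\{a,b\}\cup\{L(k)\in(a,b):0\le k\le n\}\cup\{U(k)\in(a,b):0\le k\le n\}.$$
   Context: $\Pr\{E\mid p\}$ denotes the probability of $E$ when the binomial parameter has value $p$ (not a conditional probability). $L$ and $U$ are real-valued functions of $k$ not depending on $p$. ''Monotone'' means either non-decreasing or non-increasing; $L$ and $U$ need not be monotone in the same direction. *)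

(* Defs.v *)
From HB Require Import structures.
From mathcomp Require Import all_boot all_order all_algebra.
From mathcomp Require Import all_classical all_reals all_analysis.

Set Implicit Arguments.
Unset Strict Implicit.
Unset Printing Implicit Defensive.

Import Order.TTheory GRing.Theory Num.Theory.

Local Open Scope classical_set_scope.
Local Open Scope ring_scope.
Local Open Scope ereal_scope.

Definition mutually_independent (d d' : measure_display)
    (T : measurableType d) (T' : measurableType d') (R : realType)
    (P : probability T R) (I : finType) (X : I -> {RV P >-> T'}) : Prop :=
  forall (J : {set I}) (A : I -> set T'),
    (forall i, i \in J -> measurable (A i)) ->
    P (\bigcap_(i in [set` J]) (X i @^-1` A i)) =
    \prod_(i in J) P (X i @^-1` A i).

Arguments mutually_independent {d d' T T' R} P {I} X.

Definition iid_bernoulli (d : measure_display) (T : measurableType d)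
    (R : realType) (p : R) (P : probability T R) (n : nat)
    (X : 'I_n -> {RV P >-> nat}) : Prop :=
  mutually_independent P X /\
  forall i : 'I_n, P (X i @^-1` [set 1%N]) = p%:E /\
                   P (X i @^-1` [set 0%N]) = (1 - p)%:E.

Arguments iid_bernoulli {d T R} p P {n} X.

(* The X i take values in {0, 1} only almost surely, so the values of f beyond
   n, met by the sum of the X i on a null set at most, are left unconstrained. *)
Definition monotone_upto (R : realType) (n : nat) (f : nat -> R) : Prop :=
  {in [pred k : nat | (k <= n)%N] &, nondecreasing_fun f} \/
  {in [pred k : nat | (k <= n)%N] &, nonincreasing_fun f}.

(* P is the law on the sample space when the binomial parameter equals p. *)
Definition coverage (d : measure_display) (T : measurableType d)
    (R : realType) (P : probability T R) (K : T -> nat) (L U : nat -> R)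
    (p : R) : \bar R :=
  P [set w | (L (K w) < p)%R /\ (p < U (K w))%R].

(* Main.v *)
(* For fixed p the indices k with L k < p < U k form an interval i <= k < j,
   because L and U are monotone.  The probability that K falls in a fixed
   interval is quasi-concave in the parameter: its derivative telescopes to
   i C(n,i) x^(i-1) (1-x)^(n-i) - j C(n,j) x^(j-1) (1-x)^(n-j), which changes
   sign at most once, from + to -.  Hence between two consecutive points q1, q2
   of the discrete set this probability is at least its smaller endpoint value.
   At q1 and q2 the strict inequalities can only drop indices, so the coverage
   there is smaller still. *)

Require Import Defs.
From HB Require Import structures.
From mathcomp Require Import all_boot all_order all_algebra.
From mathcomp Require Import polyrcf ring lra.
From mathcomp Require Import all_classical all_reals all_analysis.

Set Implicit Arguments.
Unset Strict Implicit.
Unset Printing Implicit Defensive.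

Import Order.TTheory GRing.Theory Num.Theory.

Local Open Scope classical_set_scope.
Local Open Scope ring_scope.

(** * Binomial polynomials and derivatives of their interval sums *)

Definition binomial_poly (R : nzRingType) (n k : nat) : {poly R} :=
  ('X^k * (1 - 'X) ^+ (n - k)) *+ 'C(n, k).

Lemma binomial_polyE (R : comNzRingType) (n k : nat) (x : R) :
  (binomial_poly R n k).[x] = (x ^+ k * (1 - x) ^+ (n - k)) *+ 'C(n, k).
Proof. by rewrite /binomial_poly !(hornerE, hornerMn, horner_exp). Qed.

Lemma binomial_poly_ge0 (R : realDomainType) (n k : nat) (x : R) :
  0 <= x <= 1 -> 0 <= (binomial_poly R n k).[x].
Proof.
move=> /andP[x0 x1].
by rewrite binomial_polyE mulrn_wge0// mulr_ge0 ?exprn_ge0 ?subr_ge0.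
Qed.

(* The factor m * 'C(n, m) vanishes at m = 0 and for m > n, so that the
   truncated exponents m.-1 and n - m never matter. *)
Lemma deriv_binomial_cdf (R : comNzRingType) (n m : nat) :
  (\sum_(0 <= k < m) binomial_poly R n k)^`() =
  - (('X^(m.-1) * (1 - 'X) ^+ (n - m)) *+ (m * 'C(n, m))).
Proof.
elim: m => [|m IHm]; first by rewrite big_geq// deriv0 mul0n mulr0n oppr0.
(* The product rule splits the derivative of the new term in two: one half cancels the induction
   hypothesis, the other is the claim, since [m.+1 * 'C(n, m.+1) = (n - m) * 'C(n, m)]. *)
rewrite big_nat_recr//= derivD IHm mul_bin_left /binomial_poly derivMn derivM.
rewrite derivXn deriv_exp derivB -[1]/(1%:P) derivC derivX sub0r -subnS.
rewrite !mulrnA mulNr mul1r mulNrn.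
by rewrite mulrnAl mulrN mulrnDl addKr mulNrn mulrnAr.
Qed.

Definition binomial_itv (R : nzRingType) (n i j : nat) : {poly R} :=
  \sum_(i <= k < j) binomial_poly R n k.

(* The derivative is a positive multiple of A (1 - z)^(j-i) - B z^(j-i), which
   decreases in z. *)
Lemma deriv_binomial_itv_sign (R : realFieldType) (n i j : nat) (x y : R) :
    (i < j)%N -> 0 < x -> x <= y -> y < 1 ->
  (binomial_itv R n i j)^`().[x] < 0 -> (binomial_itv R n i j)^`().[y] <= 0.
Proof.
move=> ij x0 xy y1; set g := binomial_itv R n i j.
have y0 : 0 < y by exact: lt_le_trans xy.
have x1 : x < 1 by exact: le_lt_trans xy y1.
pose A : R := (i * 'C(n, i))%:R; pose B : R := (j * 'C(n, j))%:R.
have gE z : g^`().[z] = A * (z ^+ i.-1 * (1 - z) ^+ (n - i))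
    - B * (z ^+ j.-1 * (1 - z) ^+ (n - j)).
  have -> : g = \sum_(0 <= k < j) binomial_poly R n k
      - \sum_(0 <= k < i) binomial_poly R n k.
    by rewrite (big_cat_nat (n := i) _ (ltnW ij))//= addrAC subrr add0r.
  rewrite derivB !deriv_binomial_cdf.
  rewrite !(hornerD, hornerN, hornerMn, hornerM, horner_exp, hornerX, hornerC).
  by rewrite -[_ *+ (i * _)]mulr_natr -[_ *+ (j * _)]mulr_natr -/A -/B; ring.
have A0 : 0 <= A by exact: ler0n.
have B0 : 0 <= B by exact: ler0n.
(* For [j > n] the coefficient [B] vanishes, so the derivative at [x] is nonnegative, against the
   hypothesis. *)
have [nj|jn] := ltnP n j.
  rewrite gE ltNge => /negP[].
  rewrite {1}/B bin_small// muln0 mul0r subr0.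
  by rewrite !mulr_ge0 ?exprn_ge0 ?subr_ge0// ltW.
(* For [i = 0] the coefficient [A] vanishes and the derivative is nonpositive throughout. For
   [i > 0], [i.-1] is a true predecessor, so [j.-1 = i.-1 + m] and the common powers factor out. *)
case: (posnP i) => [i0 _|i0].
  rewrite gE {1}/A i0 mul0n mul0r sub0r oppr_le0.
  by rewrite !mulr_ge0 ?exprn_ge0 ?subr_ge0// ltW.
pose m := (j - i)%N.
have hE z : g^`().[z] =
    (z ^+ i.-1 * (1 - z) ^+ (n - j)) * (A * (1 - z) ^+ m - B * z ^+ m).
  rewrite gE.
  have -> : j.-1 = (i.-1 + m)%N.
    by rewrite /m -subn1 -subn1 addnBAC// subnKC// ltnW.
  have -> : (n - i = (n - j) + m)%N by rewrite /m addnBA ?subnK// ltnW.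
  by rewrite !exprD; ring.
rewrite !hE pmulr_rlt0 ?mulr_gt0 ?exprn_gt0 ?subr_gt0// => /ltW.
rewrite pmulr_rle0 ?mulr_gt0 ?exprn_gt0 ?subr_gt0//.
rewrite !subr_le0 => h.
apply: (le_trans _ (le_trans h _)); rewrite ler_wpM2l//.
  by apply: lerXn2r; rewrite ?nnegrE; lra.
by apply: lerXn2r; rewrite ?nnegrE; lra.
Qed.

(** A value at [p] below both end values would, by the mean value theorem, force a negative
    derivative left of [p] and a positive one right of it, against [deriv_binomial_itv_sign]. *)
Lemma binomial_itv_quasiconcave (R : rcfType) (n i j : nat) (x p y : R) :
    0 < x -> x <= p -> p <= y -> y < 1 ->
  Num.min (binomial_itv R n i j).[x] (binomial_itv R n i j).[y] <=
  (binomial_itv R n i j).[p].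
Proof.
move=> x0 xp py y1; set g := binomial_itv R n i j; rewrite leNgt lt_min.
apply/negP => /andP[gpx gpy].
have [ji|ij] := leqP j i.
  by rewrite /g /binomial_itv big_geq// !hornerE ltxx in gpx.
have ltxp : x < p.
  by rewrite lt_neqAle xp andbT; apply: contraTneq gpx => ->; rewrite ltxx.
have ltpy : p < y.
  by rewrite lt_neqAle py andbT; apply: contraTneq gpy => ->; rewrite ltxx.
have [c /itvP cP cE] := poly_mvt g ltxp.
have [c' /itvP c'P c'E] := poly_mvt g ltpy.
have gc : g^`().[c] < 0.
  by rewrite -(pmulr_llt0 _ (x := p - x)) ?subr_gt0// -cE subr_lt0.
have : 0 < g^`().[c'].
  by rewrite -(pmulr_lgt0 _ (x := y - p)) ?subr_gt0// -c'E subr_gt0.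
rewrite ltNge => /negP[]; apply: deriv_binomial_itv_sign gc => //.
- by rewrite (lt_trans x0)// cP.
- by rewrite (@le_trans _ _ p)// ?cP ?c'P.
- by rewrite (lt_trans _ y1)// c'P.
Qed.

(** * The law of a sum of independent Bernoulli variables *)

Section binomial_law.
Context (R : realType) (d : measure_display) (T : measurableType d).
Context (P : probability T R) (n : nat) (X : 'I_n -> {mfun T >-> nat}) (p : R).
Context (iidX : iid_bernoulli p P X).

Let K := fun w : T => (\sum_(i < n) X i w)%N.

(** Written as an intersection over the full index set, so that independence applies directly with
    that set. *)
Let pattern (J : {set 'I_n}) : set T :=
  \bigcap_(i in [set` [set: 'I_n]%SET]) (X i @^-1` [set (i \in J : nat)]).

Let weight (k : nat) : R := p ^+ k * (1 - p) ^+ (n - k).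

Let measurable_preimage (i : 'I_n) (A : set nat) : measurable (X i @^-1` A).
Proof. by rewrite -[_ @^-1` _]setTI; exact: measurable_funP. Qed.

Let measurable_pattern (J : {set 'I_n}) : measurable (pattern J).
Proof. by apply: fin_bigcap_measurable. Qed.

Let probability_pattern (J : {set 'I_n}) : P (pattern J) = (weight #|J|)%:E.
Proof.
case: iidX => indX marginal.
rewrite /pattern (indX [set: 'I_n]%SET (fun i => [set (i \in J : nat)]))//.
rewrite (eq_bigr (fun i => (if i \in J then p else 1 - p)%:E)); last first.
  by move=> i _; have [X1 X0] := marginal i; case: ifP.
rewrite prodEFin (bigID (mem J))/=; congr (_ * _)%:E.
  rewrite (eq_big (mem J) (fun=> p)) ?prodr_const//.
    by move=> i; rewrite !inE.
  by move=> i /andP[_ ->].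
rewrite (eq_big (mem (~: J)) (fun=> 1 - p)).
- by rewrite prodr_const cardsCs finset.setCK card_ord.
- by move=> i; rewrite !inE.
- by move=> i /andP[_ /negbTE ->].
Qed.

Let trivIset_pattern : trivIset [set: {set 'I_n}] pattern.
Proof.
move=> J J' _ _ [w [wJ wJ']]; apply/setP => i.
have := wJ i; have := wJ' i; rewrite /= !inE => /(_ isT) -> /(_ isT).
by case: (i \in J); case: (i \in J').
Qed.

Let sum_pattern (J : {set 'I_n}) (w : T) : pattern J w -> K w = #|J|.
Proof.
move=> wJ; rewrite /K -sum1_card [RHS]big_mkcond/=; apply: eq_bigr => i _.
by rewrite (wJ i) /= ?inE//; case: ifP.
Qed.

Let measurable_sum_event (S : pred nat) : measurable [set w | S (K w)].
Proof.
have mK : measurable_fun setT K.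
  rewrite /K; elim: index_enum => [|i s ms].
    by under eq_fun do rewrite big_nil; exact: measurable_cst.
  under eq_fun do rewrite big_cons.
  exact: measurable_realfun.measurable_fun_addn.
by rewrite -[X in measurable X]setTI; exact: (mK measurableT [set k | S k]).
Qed.

(* Only an inequality, since the X i may leave {0, 1} on a null set; the same
   bound for the complement of S gives the converse. *)
Let weight_le_probability (S : pred nat) :
  ((\sum_(J : {set 'I_n} | S #|J|) weight #|J|)%:E <= P [set w | S (K w)])%E.
Proof.
rewrite -sumEFin (eq_bigr (fun J => P (pattern J))); last first.
  by move=> J _; rewrite probability_pattern.
rewrite (bigfs _ (index_enum_uniq _)); last by move=> i; rewrite mem_index_enum.
rewrite -measure_fin_bigcup//; last first.
  by apply: sub_trivIset trivIset_pattern.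
rewrite le_measure// ?inE//.
  by apply: fin_bigcup_measurable.
by move=> w [J /= SJ /sum_pattern ->].
Qed.

(** Expanding the [n]-th power of [p + (1 - p)] by distributivity yields one product per subset
    [J]. *)
Let sum_weight : \sum_(J : {set 'I_n}) weight #|J| = 1.
Proof.
transitivity ((p + (1 - p)) ^+ n); last by rewrite addrC subrK expr1n.
rewrite -[in RHS](card_ord n) -prodr_const bigA_distr; apply: eq_bigr => J _.
rewrite (bigID (mem J))/= /weight; congr (_ * _).
  by rewrite -prodr_const; apply: eq_bigr => i ->.
rewrite (eq_big (mem (~: J)) (fun=> 1 - p)).
- by rewrite prodr_const cardsCs finset.setCK card_ord.
- by move=> i; rewrite !inE.
- by move=> i /negbTE ->.
Qed.

Lemma probability_sum_bernoulli (S : pred nat) :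
  P [set w | S (K w)] =
  (\sum_(0 <= k < n.+1 | S k) (binomial_poly R n k).[p])%:E.
Proof.
have -> : \sum_(0 <= k < n.+1 | S k) (binomial_poly R n k).[p] =
    \sum_(J : {set 'I_n} | S #|J|) weight #|J|.
  have cardJ (J : {set 'I_n}) : (#|J| < n.+1)%N.
    by rewrite ltnS -[leqRHS]card_ord max_card.
  rewrite big_mkord.
  (* Subsets are grouped by cardinality; ['C(n, k)] of them have size [k]. *)
  rewrite (partition_big (fun J => Ordinal (cardJ J)) (fun k => S k))//=.
  apply: eq_bigr => k Sk.
  rewrite (eq_big (mem [set J : {set 'I_n} | #|J| == k]%SET) (fun=> weight k)).
  - by rewrite sumr_const card_draws card_ord binomial_polyE.
  - move=> J; rewrite !inE -[Ordinal _ == k]val_eqE/=.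
    by case: eqP => [->|_]; rewrite ?Sk ?andbF.
  - by move=> J /andP[_ /eqP <-].
apply/eqP; rewrite eq_le weight_le_probability andbT.
(* Since the weights total one, the lower bound for the complement is an upper bound for [S]. *)
have := weight_le_probability (predC S).
rewrite (_ : [set w | _] = ~` [set w | S (K w)]); last first.
  by apply/seteqP; split=> w /= /negP.
rewrite probability_setC//.
rewrite -(fineK (fin_num_measure P _ (measurable_sum_event S))).
rewrite -EFinB !lee_fin.
have := sum_weight; rewrite (bigID (fun J : {set 'I_n} => S #|J|))/=; lra.
Qed.

End binomial_law.

(** * Finite minima, and intervals of covering indices *)

Lemma seq_argmin (d : Order.disp_t) (T : eqType) (R : orderType d) (f : T -> R)
    (x : T) (s : seq T) :
  x \in s -> exists2 y, y \in s & forall z, z \in s -> (f y <= f z)%O.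
Proof.
elim: s x => // t s IHs _ _; case: s IHs => [_|u s IHs].
  by exists t => [|z]; rewrite inE// => /eqP ->.
have [y ys ymin] := IHs u (mem_head _ _).
have [ty|yt] := leP (f t) (f y).
- exists t => [|z]; rewrite ?mem_head// inE => /predU1P[->//|zs].
  exact: le_trans (ymin z zs).
- exists y => [|z]; rewrite inE ?ys ?orbT// => /predU1P[->|/ymin//].
  exact: ltW.
Qed.

(** Min and max treat both directions of monotonicity at once; the upper bound serves [L], the lower
    one [U]. *)
Lemma monotone_upto_between (R : realType) (n : nat) (f : nat -> R)
    (i j k : nat) :
    monotone_upto n f -> (i <= j)%N -> (j <= k)%N -> (k <= n)%N ->
  Num.min (f i) (f k) <= f j <= Num.max (f i) (f k).
Proof.
move=> mf ij jk kn; rewrite ge_min le_max.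
have jn := leq_trans jk kn; have iN := leq_trans ij jn.
by case: mf => mf; rewrite (mf i j)// ?(mf j k)// orbT.
Qed.

Definition covering (R : realType) (L U : nat -> R) (p : R) : pred nat :=
  [pred k | L k < p < U k].

Lemma covering_convex (R : realType) (n : nat) (L U : nat -> R) (p : R)
    (i j k : nat) :
    monotone_upto n L -> monotone_upto n U ->
    (i <= j)%N -> (j <= k)%N -> (k <= n)%N ->
  covering L U p i -> covering L U p k -> covering L U p j.
Proof.
move=> mL mU ij jk kn /andP[Li Ui] /andP[Lk Uk]; apply/andP; split.
- have /andP[_ /le_lt_trans] := monotone_upto_between mL ij jk kn.
  by apply; rewrite gt_max Li.
- have /andP[/(lt_le_trans _)+ _] := monotone_upto_between mU ij jk kn.
  by apply; rewrite lt_min Ui.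
Qed.

(** The ends are the least member and the successor of the greatest one up to [n]; if there is no
    member, [0] and [0] give an empty interval. *)
Lemma convex_upto_itv (n : nat) (S : pred nat) :
    (forall i j k, (i <= j)%N -> (j <= k)%N -> (k <= n)%N ->
      S i -> S k -> S j) ->
  exists i j, (j <= n.+1)%N /\
    forall k, (k <= n)%N -> S k = (i <= k < j)%N.
Proof.
move=> convS.
have [/hasP[k0]|/hasPn S0] := boolP (has S (iota 0 n.+1)); last first.
  exists 0%N, 0%N; split=> // k kn; apply/negbTE/S0.
  by rewrite mem_iota add0n ltnS.
rewrite mem_iota add0n ltnS => /= k0n Sk0.
have ex : exists k, S k && (k <= n)%N by exists k0; rewrite Sk0.
have bounded k : S k && (k <= n)%N -> (k <= n)%N by case/andP.
have [i /andP[Si iN] imin] := ex_minnP ex.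
have [j /andP[Sj jn] jmax] := ex_maxnP ex bounded.
exists i, j.+1; split=> // k kn; rewrite ltnS.
apply/idP/andP => [Sk|[ik kj]]; last exact: (convS i k j).
by rewrite imin ?jmax// Sk.
Qed.

(** [S] and [p] are separate arguments, so that the parameter can move while the index set stays
    frozen. *)
Definition binomial_mass (R : realType) (n : nat) (S : pred nat) (p : R) : R :=
  \sum_(0 <= k < n.+1 | S k) (binomial_poly R n k).[p].

Lemma binomial_mass_quasiconcave (R : realType) (n : nat) (S : pred nat)
    (x p y : R) :
    (forall i j k, (i <= j)%N -> (j <= k)%N -> (k <= n)%N ->
      S i -> S k -> S j) ->
    0 < x -> x <= p -> p <= y -> y < 1 ->
  Num.min (binomial_mass n S x) (binomial_mass n S y) <= binomial_mass n S p.
Proof.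
move=> /convex_upto_itv[i [j [jn SE]]].
(* As [j <= n.+1], both sums range over indices below [n.+1], where [SE] applies. *)
have massE z : binomial_mass n S z = (binomial_itv R n i j).[z].
  rewrite /binomial_itv horner_sum (big_nat_widenl i 0)//=.
  rewrite (big_nat_widen 0 j n.+1)//=.
  rewrite /binomial_mass [LHS]big_nat_cond [RHS]big_nat_cond.
  apply: eq_bigl => k /=.
  by case: ltnP => //= kn; rewrite SE.
by rewrite !massE; exact: binomial_itv_quasiconcave.
Qed.

Lemma binomial_mass_subset (R : realType) (n : nat) (S S' : pred nat) (p : R) :
    0 <= p <= 1 -> (forall k, (k <= n)%N -> S k -> S' k) ->
  binomial_mass n S p <= binomial_mass n S' p.
Proof.
move=> p01 SS'; rewrite /binomial_mass big_mkcond [leRHS]big_mkcond.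
apply: ler_sum_nat => k /andP[_ kn].
have := SS' k kn; case: (S k) => [->//|_]; case: ifP => // _.
exact: binomial_poly_ge0.
Qed.

(** * Minimum of the coverage over the discrete set *)

Theorem theorem1 (R : realType) (d : measure_display) (T : measurableType d)
    (n : nat) (X : 'I_n -> {mfun T >-> nat}) (P : R -> probability T R)
    (L U : nat -> R) (a b : R) :
  (1 <= n)%N ->
  (forall p, 0 < p < 1 -> iid_bernoulli p (P p) X) ->
  0 < a -> a <= b -> b < 1 ->
  monotone_upto n L -> monotone_upto n U ->
  let K := fun w : T => (\sum_(i < n) X i w)%N in
  exists2 p0 : R,
    ([set a; b] `|` ([set L k | k in `I_n.+1] `&` `]a, b[%classic)
                `|` ([set U k | k in `I_n.+1] `&` `]a, b[%classic)) p0
  & forall p : R, p \in `[a, b] ->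
      (coverage (P p0) K L U p0 <= coverage (P p) K L U p)%E.
Proof.
move=> _ iidX a0 ab b1 mL mU K.
pose c p := binomial_mass n (covering L U p) p.
have coverageE p : a <= p <= b -> coverage (P p) K L U p = (c p)%:E.
  move=> /andP[ap pb]; rewrite /coverage.
  have p01 : 0 < p < 1 by rewrite (lt_le_trans a0)// (le_lt_trans pb).
  rewrite -(probability_sum_bernoulli (iidX p p01)).
  by congr (P p _); apply/seteqP; split=> w /= /andP.
pose D := [:: a, b & [seq q <- map L (iota 0 n.+1) ++ map U (iota 0 n.+1) |
                       a < q < b]].
have aD : a \in D by rewrite mem_head.
have bD : b \in D by rewrite !inE eqxx orbT.
have Dab q : q \in D -> a <= q <= b.
  rewrite !inE mem_filter => /or3P[/eqP->|/eqP->|/andP[/andP[aq qb] _]].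
  - by rewrite lexx.
  - by rewrite lexx andbT.
  - by rewrite !ltW.
(* The closed interval suffices, because a limit equal to [a] or [b] is in [D] as an endpoint. *)
have memD f k : f = L \/ f = U -> (k <= n)%N -> a <= f k <= b -> f k \in D.
  move=> fLU kn /andP[]; rewrite le_eqVlt => /predU1P[<- //|af].
  rewrite le_eqVlt => /predU1P[-> //|fb].
  have kI : k \in iota 0 n.+1 by rewrite mem_iota add0n ltnS.
  rewrite !inE mem_filter af fb mem_cat.
  by case: fLU => ->; rewrite (map_f _ kI) !orbT.
have [p0 p0D p0min] := seq_argmin c aD.
exists p0.
  move: p0D; rewrite !inE mem_filter mem_cat.
  move=> /or3P[/eqP->|/eqP->|/andP[p0ab /orP[]/mapP[k + p0E]]].
  - by left; left; left.
  - by left; left; right.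
  - rewrite mem_iota => /= kn; left; right; split; last by rewrite /= in_itv.
    by exists k.
  - rewrite mem_iota => /= kn; right; split; last by rewrite /= in_itv.
    by exists k.
move=> p; rewrite in_itv/= => pab; rewrite coverageE; last exact: Dab.
rewrite coverageE// lee_fin.
have /andP[ap pb] := pab.
(* [q1] and [q2] are the points of [D] nearest to [p] on either side; [a] and [b] ensure that they
   exist, and minimising the negation gives the greatest point. *)
have [q1] : exists2 y, y \in [seq q <- D | q <= p] &
    forall z, z \in [seq q <- D | q <= p] -> - y <= - z.
  by apply: (seq_argmin (x := a) -%R); rewrite mem_filter ap.
rewrite mem_filter => /andP[q1p q1D] q1max.
have [q2] : exists2 y, y \in [seq q <- D | p <= q] &
    forall z, z \in [seq q <- D | p <= q] -> y <= z.
  by apply: (seq_argmin (x := b) id); rewrite mem_filter pb.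
rewrite mem_filter => /andP[pq2 q2D] q2min.
have /andP[aq1 q1b] := Dab _ q1D; have /andP[aq2 q2b] := Dab _ q2D.
(* The minimum is at most [c q], and enlarging the index set from that of [q] to that of [p] only
   adds nonnegative terms. *)
have c_le_mass q : q \in D -> (forall k, (k <= n)%N -> covering L U q k ->
    covering L U p k) -> c p0 <= binomial_mass n (covering L U p) q.
  move=> qD sub; apply: le_trans (p0min q qD) _.
  apply: binomial_mass_subset => //.
  have /andP[aq qb] := Dab _ qD.
  by rewrite (le_trans (ltW a0))// (le_trans qb)// ltW.
apply: (@le_trans _ _ (Num.min (binomial_mass n (covering L U p) q1)
                               (binomial_mass n (covering L U p) q2))).
  (* At [q2], [p <= L k < q2] would put a point of [D] closer to [p]; at [q1], [q1 < U k <= p] would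
     do the same. The other two inequalities follow from [q1 <= p <= q2]. *)
  rewrite le_min !c_le_mass// => k kn /andP[Lq qU]; apply/andP; split.
  - rewrite ltNge; apply/negP => pL; have := q2min (L k).
    rewrite mem_filter pL memD//; first by move=> /(_ isT); rewrite leNgt Lq.
      by left.
    by rewrite (le_trans ap pL) (le_trans (ltW Lq)).
  - exact: le_lt_trans qU.
  - exact: lt_le_trans q1p.
  - rewrite ltNge; apply/negP => Up; have := q1max (U k).
    rewrite mem_filter Up memD//.
    + by move=> /(_ isT); rewrite lerN2 leNgt qU.
    + by right.
    + by rewrite (le_trans Up pb) (le_trans aq1 (ltW qU)).
apply: binomial_mass_quasiconcave => //.
- by move=> i j k; exact: covering_convex.
- exact: lt_le_trans aq1.
- exact: le_lt_trans b1.
Qed.
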